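(* Assume that the points $x_1,\dots,x_m$ are such that the matrix $W$ below is nonsingular. Let $D(x)=c+g^\top(x-x_0)+\tfrac12(x-x_0)^\top H_D(x-x_0)$ be the solution of the minimum Frobenius norm problem $$\min_{D}\ \tfrac12\|\nabla^2 D\|_F^2\quad\text{s.t.}\quad D(x_i)=r_i,\ i=1,\dots,m,$$ and let $\lambda\in\mathbb{R}^m$ be the associated vector of Lagrange multipliers. Then the parameters $(\lambda^\top,c,g^\top)^\top$ are uniquely determined by the symmetric block linear system $$W\begin{pmatrix}\lambda\\ c\\ g\end{pmatrix}=\begin{pmatrix} r\\ 0\\ 0\end{pmatrix},\qquad W=\begin{pmatrix}A & X^\top\\ X & 0\end{pmatrix}\in\mathbb{R}^{(m+n+1)\times(m+n+1)},$$ where $r=(r_1,\dots,r_m)^\top$, $X\in\mathbb{R}^{(n+1)\times m}$ has $i$-th column $(1,(x_i-x_0)^\top)^\top$, the lower right block is the $(n+1)\times(n+1)$ zero matrix, and the geometric sub-matrix $A\in\mathbb{R}^{m\times m}$ depends only on squared Euclidean inner products of the shifted points: $A_{ij}=\tfrac12\langle x_i-x_0,\,x_j-x_0\rangle^2$ for $1\le i,j\le m$.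
   Context: $n\ge1$; $m$ is an integer with $n+2\le m\le\frac12(n+1)(n+2)$; $x_0\in\mathbb{R}^n$ is a fixed base point; $x_1,\dots,x_m\in\mathbb{R}^n$ are distinct interpolation points; $r_1,\dots,r_m\in\mathbb{R}$ are given residuals. The minimization is over quadratic polynomials $D(x)=c+g^\top(x-x_0)+\frac12(x-x_0)^\top H_D(x-x_0)$ with $c\in\mathbb{R}$, $g\in\mathbb{R}^n$ and $H_D=\nabla^2D\in\mathbb{R}^{n\times n}$ symmetric; $\|\cdot\|_F$ is the Frobenius norm. The Lagrange multipliers are those of the Lagrangian (with this normalization) $$\mathcal{L}(H_D,g,c,\lambda)=\tfrac12\|H_D\|_F^2-2\sum_{i=1}^m\lambda_i\Big[c+g^\top(x_i-x_0)+\tfrac12(x_i-x_0)^\top H_D(x_i-x_0)-r_i\Big],$$ i.e. $\lambda$ is such that the partial derivatives of $\mathcal{L}$ with respect to $c$, $g$ and the symmetric matrix $H_D$ vanish at the solution. *)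

(* Defs.v *)
From mathcomp Require Import all_boot all_order all_algebra.
From mathcomp Require Import all_classical all_reals all_analysis.
From mathcomp Require Import ring.

Set Implicit Arguments.
Unset Strict Implicit.
Unset Printing Implicit Defensive.

Import Order.TTheory GRing.Theory Num.Theory.
Import numFieldNormedType.Exports.

Local Open Scope classical_set_scope.
Local Open Scope ring_scope.

Section MinimumFrobeniusNorm.
Variable R : realType.

Definition dotc (n : nat) (u v : 'cV[R]_n) : R := (u^T *m v) 0 0.

(* The norm of the normed module 'M[R]_(m, n) is the max norm, hence this
   separate definition. *)
Definition frob (m n : nat) (A : 'M[R]_(m, n)) : R :=
  Num.sqrt (\sum_i \sum_j A i j ^+ 2).

Definition hessian (n : nat) (D : 'cV[R]_n -> R) (x : 'cV[R]_n) : 'M[R]_n :=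
  \matrix_(i, j) 'D_(delta_mx i 0) (fun y => 'D_(delta_mx j 0) D y) x.

Definition quad (n : nat) (x0 : 'cV[R]_n) (c : R) (g : 'cV[R]_n) (H : 'M[R]_n)
    (x : 'cV[R]_n) : R :=
  c + dotc g (x - x0) + 2^-1 * dotc (x - x0) (H *m (x - x0)).

Definition is_quadratic (n : nat) (x0 : 'cV[R]_n) (D : 'cV[R]_n -> R) : Prop :=
  exists c g H, H^T = H /\ D = quad x0 c g H.

Lemma is_derive_quadratic_expansion (V : normedModType R) (f : V -> R)
    (a v : V) (p q : R) :
  (forall h : R, f (h *: v + a) = f a + h * p + h ^+ 2 * q) -> is_derive a v f p.
Proof.
move=> fE.
have cv : (fun h : R => h^-1 *: ((f \o shift a) (h *: v) - f a)) @ 0^' --> p.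
  have cv1 : (fun h : R => p + h * q) @ 0^' --> p.
    rewrite -[X in _ --> X]addr0; apply: cvgD; first exact: cvg_cst.
    rewrite -[X in _ --> X](mul0r q); apply: cvgMl.
    exact: nbhs_dnbhs.
  apply: cvg_trans cv1; apply: near_eq_cvg; near=> h.
  have h0 : h != 0 by near: h; exact: nbhs_dnbhs_neq.
  by rewrite /= fE /GRing.scale /=; field.
by split; [exact: cvgP cv | exact: cvg_lim cv].
Unshelve. all: by end_near. Qed.

Lemma dotcC (n : nat) (u v : 'cV[R]_n) : dotc u v = dotc v u.
Proof. by rewrite /dotc -[v in LHS]trmxK -trmx_mul mxE. Qed.

Lemma dotcDl (n : nat) (u v w : 'cV[R]_n) : dotc (u + v) w = dotc u w + dotc v w.
Proof. by rewrite /dotc linearD mulmxDl mxE. Qed.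

Lemma dotcZl (n : nat) (a : R) (u v : 'cV[R]_n) : dotc (a *: u) v = a * dotc u v.
Proof. by rewrite /dotc linearZ /= -scalemxAl mxE. Qed.

Lemma dotcDr (n : nat) (u v w : 'cV[R]_n) : dotc w (u + v) = dotc w u + dotc w v.
Proof. by rewrite !(dotcC w) dotcDl. Qed.

Lemma dotcZr (n : nat) (a : R) (u v : 'cV[R]_n) : dotc v (a *: u) = a * dotc v u.
Proof. by rewrite !(dotcC v) dotcZl. Qed.

Lemma dotc_symm (n : nat) (H : 'M[R]_n) (u v : 'cV[R]_n) :
  H^T = H -> dotc u (H *m v) = dotc v (H *m u).
Proof. by move=> HT; rewrite [RHS]dotcC /dotc trmx_mul HT mulmxA. Qed.

Lemma derive_quad (n : nat) (x0 : 'cV[R]_n) (c : R) (g : 'cV[R]_n) (H : 'M[R]_n)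
    (x v : 'cV[R]_n) :
  H^T = H -> 'D_v (quad x0 c g H) x = dotc v g + dotc v (H *m (x - x0)).
Proof.
move=> HT; apply: derive_val.
apply: (@is_derive_quadratic_expansion _ _ _ _ _ (2^-1 * dotc v (H *m v))) => h.
rewrite /quad -(addrA (h *: v)); move: (x - x0) => y.
rewrite mulmxDr -scalemxAr !(dotcDl, dotcDr, dotcZl, dotcZr).
by rewrite (dotcC g v) (dotc_symm y v HT); field.
Qed.

Lemma hessian_quad (n : nat) (x0 : 'cV[R]_n) (c : R) (g : 'cV[R]_n)
    (H : 'M[R]_n) (x : 'cV[R]_n) :
  H^T = H -> hessian (quad x0 c g H) x = H.
Proof.
move=> HT; apply/matrixP => i j; rewrite mxE.
under eq_fun do rewrite derive_quad//.
apply: derive_val.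
rewrite (_ : H i j = dotc (delta_mx j 0) (H *m delta_mx i 0)); last first.
  by rewrite -colE /dotc trmx_delta -rowE !mxE -[in LHS]HT mxE.
apply: (@is_derive_quadratic_expansion _ _ _ _ _ 0) => h.
by rewrite -addrA mulmxDr -scalemxAr dotcDr dotcZr; ring.
Qed.

Section Problem.
Variables (n m : nat) (x0 : 'cV[R]_n) (x : 'I_m -> 'cV[R]_n) (r : 'cV[R]_m).

Definition interpolates (D : 'cV[R]_n -> R) : Prop :=
  forall i, D (x i) = r i 0.

(* The Hessian of a quadratic polynomial is constant (see [hessian_quad]), so
   the point at which it is taken is immaterial. *)
Definition objective (D : 'cV[R]_n -> R) : R :=
  2^-1 * frob (hessian D x0) ^+ 2.

Definition min_frob_solution (D : 'cV[R]_n -> R) : Prop :=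
  [/\ is_quadratic x0 D, interpolates D &
      forall D', is_quadratic x0 D' -> interpolates D' ->
        objective D <= objective D'].

Definition lagrangian (H : 'M[R]_n) (g : 'cV[R]_n) (c : R) (lam : 'cV[R]_m) : R :=
  2^-1 * frob H ^+ 2
  - 2 * \sum_i lam i 0 *
      (c + dotc g (x i - x0) + 2^-1 * dotc (x i - x0) (H *m (x i - x0)) - r i 0).

(* [H] ranges over the space of symmetric matrices, so the Lagrangian is
   differentiated in [H] along the symmetric directions only. *)
Definition lagrange_multiplier (c : R) (g : 'cV[R]_n) (H : 'M[R]_n)
    (lam : 'cV[R]_m) : Prop :=
  [/\ is_derive c 1 (fun c' => lagrangian H g c' lam) 0,
      forall k : 'I_n,
        is_derive g (delta_mx k 0) (fun g' => lagrangian H g' c lam) 0 &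
      forall E : 'M[R]_n, E^T = E ->
        is_derive H E (fun H' => lagrangian H' g c lam) 0].

Definition Amx : 'M[R]_m :=
  \matrix_(i, j) (2^-1 * dotc (x i - x0) (x j - x0) ^+ 2).

Definition Xmx : 'M[R]_(1 + n, m) :=
  \matrix_(k, i) (col_mx 1%:M (x i - x0) : 'cV[R]_(1 + n)) k 0.

Definition Wmx : 'M[R]_(m + (1 + n)) := block_mx Amx Xmx^T Xmx 0.

End Problem.

End MinimumFrobeniusNorm.

(* Main.v *)
Require Import Defs.
From mathcomp Require Import all_boot all_order all_algebra.
From mathcomp Require Import all_classical all_reals all_analysis.
From mathcomp Require Import ring lra.
Import Order.TTheory GRing.Theory Num.Theory.
Import numFieldNormedType.Exports.
Local Open Scope ring_scope.

(** Write y_i = x_i - x0.  The Lagrangian is a quadratic function of (c, g, H),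
    and its stationarity says exactly that X lam = 0 (from c and g) and that
    H = sum_i lam_i y_i y_i^T ([lagrange_multiplierP]): the Hessian can be
    eliminated in favour of lam.  After this elimination,
    1/2 y_i^T H y_i = 1/2 sum_j <y_i, y_j>^2 lam_j is the i-th entry of A lam,
    so the interpolation conditions become A lam + X^T (c, g) = r, and the two
    groups of equations together are the system with matrix W
    ([Wmx_systemP]).

    The link with the minimization problem is an orthogonality argument.  If
    X lam = 0, then sum_i lam_i D(x_i) sees only the quadratic part of D and
    equals half the Frobenius product of H_lam = sum_i lam_i y_i y_i^T with the
    Hessian of D ([sum_quad]).  Hence all interpolants have the same product
    with H_lam, and when H_lam is itself the Hessian of an interpolant, the
    squared norm of the Hessian H' of any other one is |H_lam|^2 + |H' - H_lam|^2
    ([interpolant_pythagoras]).  So every solution of the system gives a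
    minimizer, and every minimizer has Hessian H_lam; its own c and g, taken
    with lam, then solve the system again.  As W is invertible, the system has
    exactly one solution, which gives at once the existence and uniqueness of
    the minimizer, of its multipliers, and of (lam, c, g). *)

(** * The Frobenius inner product *)

Section Frobenius.
Context {R : realType} {n : nat}.
Implicit Types (A B E : 'M[R]_n) (u v : 'cV[R]_n).

(** The trace form makes bilinearity immediate; positivity is read off the
    entrywise form [frobdotE]. *)
Definition frobdot A B : R := \tr (A^T *m B).

Lemma frobdotE A B : frobdot A B = \sum_i \sum_j A i j * B i j.
Proof.
rewrite /frobdot /mxtrace exchange_big /=; apply: eq_bigr => j _.
by rewrite mxE; apply: eq_bigr => i _; rewrite mxE.
Qed.

Lemma frobdotC A B : frobdot A B = frobdot B A.
Proof.
rewrite !frobdotE; apply: eq_bigr => i _.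
by apply: eq_bigr => j _; rewrite mulrC.
Qed.

Lemma frobdotDr A B E : frobdot E (A + B) = frobdot E A + frobdot E B.
Proof. by rewrite /frobdot mulmxDr linearD. Qed.

Lemma frobdotZr a A E : frobdot E (a *: A) = a * frobdot E A.
Proof. by rewrite /frobdot -scalemxAr linearZ. Qed.

Lemma frobdotDl A B E : frobdot (A + B) E = frobdot A E + frobdot B E.
Proof. by rewrite !(frobdotC _ E) frobdotDr. Qed.

Lemma frobdotZl a A E : frobdot (a *: A) E = a * frobdot A E.
Proof. by rewrite !(frobdotC _ E) frobdotZr. Qed.

Lemma frobdotNr A E : frobdot E (- A) = - frobdot E A.
Proof. by rewrite -scaleN1r frobdotZr mulN1r. Qed.

Lemma frobdotNl A E : frobdot (- A) E = - frobdot A E.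
Proof. by rewrite !(frobdotC _ E) frobdotNr. Qed.

Lemma frob_sqr A : frob A ^+ 2 = frobdot A A.
Proof.
rewrite /frob sqr_sqrtr ?frobdotE; last first.
  by apply: sumr_ge0 => i _; apply: sumr_ge0 => j _; exact: sqr_ge0.
by apply: eq_bigr => i _; apply: eq_bigr => j _; rewrite expr2.
Qed.

Lemma frobdot_ge0 A : 0 <= frobdot A A.
Proof. by rewrite -frob_sqr sqr_ge0. Qed.

Lemma frobdot_eq0 A : frobdot A A = 0 -> A = 0.
Proof.
have sqA i j : 0 <= A i j * A i j by rewrite -expr2 sqr_ge0.
rewrite frobdotE => /eqP; rewrite psumr_eq0 => [/allP A0|i _]; last exact: sumr_ge0.
apply/matrixP => i j; rewrite mxE.
have := A0 i (mem_index_enum i); rewrite /= psumr_eq0 // => /allP Ai0.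
by have := Ai0 j (mem_index_enum j); rewrite /= mulf_eq0 orbb => /eqP.
Qed.

(** Quadratic forms are Frobenius products with rank-one matrices, so the
    interpolation conditions are linear in the Hessian through this product. *)
Lemma frobdot_rank1 u E : frobdot (u *m u^T) E = dotc u (E *m u).
Proof.
by rewrite /frobdot trmx_mul trmxK -mulmxA mxtrace_mulC trace_mx11 /dotc mulmxA.
Qed.

End Frobenius.

(** * Stationarity of the Lagrangian *)

(** Along each line the Lagrangian is a polynomial of degree two, so stationarity
    in a direction is the vanishing of the linear coefficient. *)
Lemma is_derive_quadratic_expansion_eq0 {R : realType} {V : normedModType R}
    {f : V -> R} {a v : V} {p q : R} :
  (forall h : R, f (h *: v + a) = f a + h * p + h ^+ 2 * q) ->
  is_derive a v f 0 <-> p = 0.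
Proof.
move=> /is_derive_quadratic_expansion fp; split=> [f0|<- //].
by rewrite -(@derive_val _ _ _ _ _ _ _ fp) (@derive_val _ _ _ _ _ _ _ f0).
Qed.

Lemma dotc_delta {R : realType} {n : nat} (k : 'I_n) (u : 'cV[R]_n) :
  dotc (delta_mx k 0) u = u k 0.
Proof. by rewrite /dotc trmx_delta -rowE mxE. Qed.

Section Multipliers.
Local Set Implicit Arguments.
Local Unset Strict Implicit.
Context {R : realType} {n m : nat}.
Variables (x0 : 'cV[R]_n) (x : 'I_m -> 'cV[R]_n) (r : 'cV[R]_m).
Implicit Types (c : R) (g : 'cV[R]_n) (H E : 'M[R]_n) (lam : 'cV[R]_m).

(** The only Hessian that is compatible with the multipliers [lam]: up to
    sign, the gradient in H of the constraint part of the Lagrangian. *)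
Definition multiplier_hessian lam : 'M[R]_n :=
  \sum_i lam i 0 *: ((x i - x0) *m (x i - x0)^T).

Lemma multiplier_hessian_sym lam :
  (multiplier_hessian lam)^T = multiplier_hessian lam.
Proof.
rewrite /multiplier_hessian linear_sum; apply: eq_bigr => i _.
by rewrite linearZ /= trmx_mul trmxK.
Qed.

Lemma frobdot_multiplier_hessian lam E :
  frobdot (multiplier_hessian lam) E =
  \sum_i lam i 0 * dotc (x i - x0) (E *m (x i - x0)).
Proof.
rewrite frobdotC /frobdot /multiplier_hessian mulmx_sumr linear_sum /=.
apply: eq_bigr => i _.
by rewrite -/(frobdot E _) frobdotZr frobdotC frobdot_rank1.
Qed.

Lemma mul_Xmx lam :
  Xmx x0 x *m lam =
  col_mx (\sum_i lam i 0)%:M (\sum_i lam i 0 *: (x i - x0)).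
Proof.
apply/colP => k; rewrite !mxE; case: split_ordP => j ->.
  rewrite ord1 mxE eqxx mulr1n; apply: eq_bigr => i _.
  by rewrite mxE col_mxEu mxE eqxx mul1r.
rewrite summxE; apply: eq_bigr => i _.
by rewrite mxE col_mxEd [in RHS]mxE mulrC.
Qed.

(** Summing the values of a quadratic against [lam] separates its three
    parameters, and the coefficients of c and g are the two blocks of X lam
    (see [mul_Xmx]).  Both the gradient of the Lagrangian and the orthogonality
    behind optimality are read off this identity. *)
Lemma sum_quad lam c g H :
  \sum_i lam i 0 * quad x0 c g H (x i) =
  c * (\sum_i lam i 0) + dotc g (\sum_i lam i 0 *: (x i - x0))
  + 2^-1 * frobdot (multiplier_hessian lam) H.
Proof.
rewrite frobdot_multiplier_hessian /dotc mulmx_sumr summxE !mulr_sumr.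
rewrite -!big_split /=; apply: eq_bigr => i _.
by rewrite /quad -scalemxAr [in RHS]mxE /dotc; ring.
Qed.

Lemma lagrangianE H g c lam :
  lagrangian x0 x r H g c lam =
  2^-1 * frobdot H H - frobdot (multiplier_hessian lam) H
  - 2 * (c * (\sum_i lam i 0) + dotc g (\sum_i lam i 0 *: (x i - x0)))
  + 2 * \sum_i lam i 0 * r i 0.
Proof.
rewrite /lagrangian frob_sqr.
under eq_bigr do rewrite -/(quad x0 c g H _) mulrBr.
by rewrite sumrB sum_quad; field.
Qed.

(** The derivative in H in the direction E is the product of
    H - multiplier_hessian lam with E.  This difference is symmetric, hence is
    itself an admissible direction, and testing against it shows that it is
    zero. *)
Lemma lagrange_multiplierP c g H lam : H^T = H ->
  lagrange_multiplier x0 x r c g H lam <->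
  Xmx x0 x *m lam = 0 /\ H = multiplier_hessian lam.
Proof.
move=> HT; set s := \sum_i lam i 0; set t := \sum_i lam i 0 *: (x i - x0).
have two0 (a : R) : - 2 * a = 0 <-> a = 0.
  split=> [|->]; last by rewrite mulr0.
  by move/eqP; rewrite mulf_eq0 oppr_eq0 pnatr_eq0 => /eqP.
have derc : is_derive c 1 (fun c' => lagrangian x0 x r H g c' lam) 0 <-> s = 0.
  rewrite -two0; apply: (@is_derive_quadratic_expansion_eq0 _ _ _ _ _ _ 0) => h.
  by rewrite !lagrangianE -/s -/t /GRing.scale /=; ring.
have derg v :
    is_derive g v (fun g' => lagrangian x0 x r H g' c lam) 0 <-> dotc v t = 0.
  rewrite -two0; apply: (@is_derive_quadratic_expansion_eq0 _ _ _ _ _ _ 0) => h.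
  by rewrite !lagrangianE -/s -/t dotcDl dotcZl; ring.
have derH E : is_derive H E (fun H' => lagrangian x0 x r H' g c lam) 0 <->
    frobdot (H - multiplier_hessian lam) E = 0.
  apply: (@is_derive_quadratic_expansion_eq0 _ _ _ _ _ _ (2^-1 * frobdot E E)) => h.
  rewrite !lagrangianE -/s -/t.
  rewrite !(frobdotDl, frobdotDr, frobdotZl, frobdotZr, frobdotNl).
  by rewrite (frobdotC E H); field.
rewrite mul_Xmx -/s -/t; split=> [[/derc s0 ig iH]|[X0 HE]].
  have t0 : t = 0.
    by apply/colP => k; rewrite mxE -dotc_delta; have /derg := ig k.
  split; first by rewrite s0 t0 raddf0 col_mx0.
  apply/eqP; rewrite -subr_eq0; apply/eqP/frobdot_eq0.
  (* H - multiplier_hessian lam is itself the test direction. *)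
  have /iH/derH // : (H - multiplier_hessian lam)^T = H - multiplier_hessian lam.
  by rewrite linearB /= HT multiplier_hessian_sym.
have [/matrixP /(_ 0 0) s0 t0] : s%:M = 0 :> 'M[R]_1 /\ t = 0.
  by apply: eq_col_mx; rewrite X0 col_mx0.
move: s0; rewrite !mxE eqxx mulr1n => s0.
split=> [|k|E _]; first exact/derc.
  by apply/derg; rewrite t0 dotc_delta mxE.
by apply/derH; rewrite HE subrr /frobdot trmx0 mul0mx linear0.
Qed.

(** * The linear system *)

(** Since the Hessian is a combination of the rank-one matrices of the points,
    y_i^T H y_i is a combination of squared inner products: this is where the
    entries of A come from. *)
Lemma mul_Amx_Xmx lam c g i :
  (Amx x0 x *m lam + (Xmx x0 x)^T *m col_mx c%:M g) i 0 =
  quad x0 c g (multiplier_hessian lam) (x i).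
Proof.
rewrite /quad addrC mxE; congr (_ + _).
  rewrite mxE big_split_ord /= big_ord1 mxE mxE !col_mxEu !mxE eqxx.
  rewrite mul1r mulr1n; congr (_ + _).
  rewrite /dotc mxE; apply: eq_bigr => k _.
  by rewrite col_mxEd mulrC; congr (_ * _); [rewrite [RHS]mxE | rewrite mxE mxE col_mxEd].
rewrite -frobdot_rank1 frobdotC frobdot_multiplier_hessian mulr_sumr mxE.
apply: eq_bigr => j _.
rewrite mxE -mulmxA [_^T *m _]mx11_scalar -/(dotc _ _) mul_mx_scalar dotcZr.
by rewrite (dotcC (x j - x0)); ring.
Qed.

Lemma Wmx_systemP lam c g :
  Wmx x0 x *m col_mx lam (col_mx c%:M g) = col_mx r (col_mx 0 0) <->
  Xmx x0 x *m lam = 0 /\ interpolates x r (quad x0 c g (multiplier_hessian lam)).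
Proof.
rewrite /Wmx mul_block_col mul0mx addr0 col_mx0; split=> [/eq_col_mx[/colP q X0]|].
  by split=> // i; rewrite -mul_Amx_Xmx.
by case=> -> q; congr col_mx; apply/colP => i; rewrite mul_Amx_Xmx.
Qed.

(** * Optimality *)

Lemma objective_quad c g H : H^T = H ->
  objective x0 (quad x0 c g H) = 2^-1 * frobdot H H.
Proof. by move=> HT; rewrite /objective hessian_quad // frob_sqr. Qed.

(** When X lam = 0 the affine part of an interpolant does not contribute to
    its values summed against [lam], and these values are prescribed. *)
Lemma frobdot_multiplier_hessian_interpolants lam c g H c' g' H' :
  Xmx x0 x *m lam = 0 ->
  interpolates x r (quad x0 c g H) -> interpolates x r (quad x0 c' g' H') ->
  frobdot (multiplier_hessian lam) H = frobdot (multiplier_hessian lam) H'.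
Proof.
rewrite mul_Xmx -[RHS]col_mx0 => /eq_col_mx[/matrixP /(_ 0 0)].
rewrite !mxE eqxx mulr1n => s0 t0 q q'.
have E c1 g1 H1 : interpolates x r (quad x0 c1 g1 H1) ->
    2^-1 * frobdot (multiplier_hessian lam) H1 = \sum_i lam i 0 * r i 0.
  move=> q1; transitivity (\sum_i lam i 0 * quad x0 c1 g1 H1 (x i)).
    by rewrite sum_quad s0 t0 mulr0 add0r /dotc mulmx0 mxE add0r.
  by apply: eq_bigr => i _; rewrite q1.
have := E _ _ _ q; rewrite -(E _ _ _ q') => /mulfI; apply.
by rewrite invr_eq0 pnatr_eq0.
Qed.

(** The difference of two interpolants has its Hessian orthogonal to
    [multiplier_hessian lam]; this yields both optimality and the uniqueness
    of the optimal Hessian. *)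
Lemma interpolant_pythagoras lam c g c' g' H' :
  Xmx x0 x *m lam = 0 ->
  interpolates x r (quad x0 c g (multiplier_hessian lam)) ->
  interpolates x r (quad x0 c' g' H') ->
  frobdot H' H' =
  frobdot (multiplier_hessian lam) (multiplier_hessian lam)
  + frobdot (H' - multiplier_hessian lam) (H' - multiplier_hessian lam).
Proof.
move=> X0 q q'.
have := frobdot_multiplier_hessian_interpolants X0 q q'.
rewrite !(frobdotDl, frobdotDr, frobdotNl, frobdotNr).
by rewrite (frobdotC H' (multiplier_hessian lam)) => ->; ring.
Qed.

Lemma Wmx_system_min_frob_solution lam c g :
  Wmx x0 x *m col_mx lam (col_mx c%:M g) = col_mx r (col_mx 0 0) ->
  min_frob_solution x0 x r (quad x0 c g (multiplier_hessian lam)).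
Proof.
move=> /Wmx_systemP[X0 q].
split; [|exact: q|].
  exists c, g, (multiplier_hessian lam).
  by split; first exact: multiplier_hessian_sym.
move=> _ [c' [g' [H' [HT' ->]]]] q'.
rewrite !objective_quad ?multiplier_hessian_sym // ler_wpM2l ?invr_ge0 //.
by rewrite (interpolant_pythagoras X0 q q') lerDl frobdot_ge0.
Qed.

(** Comparing the objectives leaves no room for H' - multiplier_hessian lam in
    the Pythagorean identity.  The coefficients c' and g' are not compared
    directly: they solve the same system as c and g, with the same [lam], so
    that an invertible W forces them to agree. *)
Lemma min_frob_solution_Wmx_system lam c g c' g' H' :
  Wmx x0 x *m col_mx lam (col_mx c%:M g) = col_mx r (col_mx 0 0) ->
  H'^T = H' -> min_frob_solution x0 x r (quad x0 c' g' H') ->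
  H' = multiplier_hessian lam /\
  Wmx x0 x *m col_mx lam (col_mx c'%:M g') = col_mx r (col_mx 0 0).
Proof.
move=> Wz HT' [_ q' min'].
have [qD q _] := Wmx_system_min_frob_solution Wz.
have [X0 _] := (Wmx_systemP _ _ _).1 Wz.
have HE : H' = multiplier_hessian lam.
  apply/eqP; rewrite -subr_eq0; apply/eqP/frobdot_eq0/eqP.
  rewrite eq_le frobdot_ge0 andbT.
  have := min' _ qD q; rewrite !objective_quad ?multiplier_hessian_sym //.
  by rewrite (interpolant_pythagoras X0 q q'); lra.
by split=> //; apply/Wmx_systemP; rewrite -HE.
Qed.

Lemma Wmx_sym : (Wmx x0 x)^T = Wmx x0 x.
Proof.
rewrite /Wmx tr_block_mx trmxK trmx0; congr block_mx.
by apply/matrixP => i j; rewrite !mxE dotcC.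
Qed.

End Multipliers.

(** * Existence and uniqueness *)

Theorem theorem1p2 (R : realType) (n m : nat) (x0 : 'cV[R]_n)
    (x : 'I_m -> 'cV[R]_n) (r : 'cV[R]_m)
    (n_ge1 : (1 <= n)%N)
    (m_ge : (n + 2 <= m)%N)
    (m_le : (2 * m <= (n + 1) * (n + 2))%N)
    (x_distinct : injective x)
    (W_nonsingular : Wmx x0 x \in unitmx) :
  [/\ (Wmx x0 x)^T = Wmx x0 x,
      exists! D : 'cV[R]_n -> R, min_frob_solution x0 x r D &
      forall (D : 'cV[R]_n -> R) (c : R) (g : 'cV[R]_n) (H : 'M[R]_n),
        min_frob_solution x0 x r D -> H^T = H -> D = quad x0 c g H ->
        (exists! lam : 'cV[R]_m, lagrange_multiplier x0 x r c g H lam) /\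
        (forall lam : 'cV[R]_m, lagrange_multiplier x0 x r c g H lam ->
           forall z : 'cV[R]_(m + (1 + n)),
             Wmx x0 x *m z = col_mx r (col_mx 0 0) <->
             z = col_mx lam (col_mx c%:M g))].
Proof.
pose b := col_mx r (col_mx 0 0) : 'cV[R]_(m + (1 + n)).
have solE z z' : Wmx x0 x *m z = b -> Wmx x0 x *m z' = b -> z = z'.
  by move=> Wz Wz'; apply: (can_inj (mulKmx W_nonsingular)); rewrite Wz Wz'.
have [lam [c [g Wz]]] : exists lam c g, Wmx x0 x *m col_mx lam (col_mx c%:M g) = b.
  pose z : 'cV[R]_(m + (1 + n)) := invmx (Wmx x0 x) *m b.
  exists (usubmx z), (usubmx (dsubmx z) 0 0), (dsubmx (dsubmx z)).
  by rewrite -mx11_scalar !vsubmxK mulKVmx.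
have solP c' g' H' : H'^T = H' -> min_frob_solution x0 x r (quad x0 c' g' H') ->
    [/\ H' = multiplier_hessian x0 x lam, c' = c & g' = g].
  move=> HT' /(min_frob_solution_Wmx_system Wz HT') [HE Wz'].
  have /eq_col_mx[_ /eq_col_mx[/matrixP /(_ 0 0) cE gE]] := solE _ _ Wz' Wz.
  by move: cE; rewrite !mxE eqxx !mulr1n.
split; first exact: Wmx_sym.
  exists (quad x0 c g (multiplier_hessian x0 x lam)).
  split=> [|D minD]; first exact: Wmx_system_min_frob_solution.
  have [[c' [g' [H' [HT' DE]]]] _ _] := minD.
  by move: minD; rewrite DE => /(solP _ _ _ HT')[-> -> ->].
move=> D c' g' H' minD HT' DE; move: minD; rewrite DE => minD.
have [HE cE gE] := solP _ _ _ HT' minD; have [_ q _] := minD.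
have mulW lam' : lagrange_multiplier x0 x r c' g' H' lam' ->
    Wmx x0 x *m col_mx lam' (col_mx c'%:M g') = b.
  by case/(lagrange_multiplierP _ _ _ _ _ _ HT') => X0 E; apply/Wmx_systemP; rewrite -E.
split.
  exists lam; split.
    by apply/lagrange_multiplierP => //; have [] := (Wmx_systemP _ _ _ _ _ _).1 Wz.
  move=> lam' /mulW Wz'; have := solE _ _ Wz Wz'.
  by case/eq_col_mx.
move=> lam' /mulW Wz' z; split=> [Wzz|-> //]; exact: solE Wzz Wz'.
Qed.
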